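(* There exist $n\ge 3$ and symmetric matrices $A_0,A_1,A_2\in\mathbb{R}^{n\times n}$ such that the problem $$\min_{x\in\mathbb{R}^n}\{x^TA_0x:\ x^TA_1x=1,\ x^TA_2x\le 1\}$$ has a non-strict local non-global minimizer; consequently, there exist such $n,A_0,A_1,A_2$ for which this problem has infinitely many local non-global minimizers.
   Context: A local non-global minimizer is a local minimizer that is not a global minimizer. A local minimizer is strict if its objective value is strictly smaller than that of all other feasible points in some neighbourhood, and non-strict otherwise. *)

(* Defs.v *)
From mathcomp Require Import all_boot all_order all_algebra.
From mathcomp Require Import all_classical all_reals all_analysis.

Set Implicit Arguments.
Unset Strict Implicit.
Unset Printing Implicit Defensive.

Import Order.TTheory GRing.Theory Num.Theory.
Import numFieldNormedType.Exports.

Local Open Scope classical_set_scope.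
Local Open Scope ring_scope.

Definition quad (R : realType) (n : nat) (A : 'M[R]_n) (x : 'cV[R]_n) : R :=
  (x^T *m A *m x) 0 0.

Definition feasible (R : realType) (n : nat) (A1 A2 : 'M[R]_n) :
  set 'cV[R]_n := [set x | quad A1 x = 1 /\ quad A2 x <= 1].

Section Minimizers.
Context {R : realType} {T : topologicalType}.
Implicit Types (f : T -> R) (F : set T) (x : T).

Definition global_minimizer f F x : Prop :=
  F x /\ forall y, F y -> f x <= f y.

Definition local_minimizer f F x : Prop :=
  F x /\ \forall y \near x, F y -> f x <= f y.

Definition strict_local_minimizer f F x : Prop :=
  F x /\ \forall y \near x, F y -> y <> x -> f x < f y.

Definition local_nonglobal_minimizer f F x : Prop :=
  local_minimizer f F x /\ ~ global_minimizer f F x.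

Definition nonstrict_local_nonglobal_minimizer f F x : Prop :=
  local_nonglobal_minimizer f F x /\ ~ strict_local_minimizer f F x.

End Minimizers.

(* Main.v *)
Require Import Defs.
From mathcomp Require Import all_boot all_order all_algebra.
From mathcomp Require Import all_classical all_reals all_analysis.
From mathcomp Require Import ring lra.

Import Order.TTheory GRing.Theory Num.Theory.
Import numFieldNormedType.Exports.

Local Open Scope classical_set_scope.
Local Open Scope ring_scope.

(** The witness lives on the unit sphere of [R^3], with coordinates
    [(x, y, z)]: minimize [2xz] subject to [x^2 + y^2 + z^2 = 1] and
    [x^2 + y^2 + z^2 - 2xy <= 1].  On the sphere the inequality says exactly
    [xy >= 0], so the feasible set is bounded by the two planes [x = 0] and
    [y = 0] instead of an irreducible quadric.  Near a point of the sphere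
    with [x = 0], [y > 0] and [z > 0] this forces [x >= 0], so the objective is
    nonnegative there, while it vanishes on the whole arc [x = 0], [y, z > 0]:
    every point of this open arc is a non-strict local minimizer
    ([arc_nonstrict]).  None of them is global, because [x, y > 0], [z < 0]
    gives a negative value.

    One non-strict local non-global minimizer always brings infinitely many
    others ([infinite_nonstrict_minimizers]): non-strictness supplies, arbitrarily
    close to it, feasible points with the same value, and these inherit local
    minimality. *)

(** If the set were finite, then, finite sets being closed, [x] would have a
    neighbourhood free of other local non-global minimizers; but a feasible [y]
    close to [x] with [f y <= f x] is itself such a minimizer, since [f x]
    bounds [f] from below near [y]. *)
Lemma infinite_nonstrict_minimizers (R : realType) (T : topologicalType)
    (f : T -> R) (F : set T) (x : T) :
  accessible_space T -> nonstrict_local_nonglobal_minimizer f F x ->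
  infinite_set [set y | local_nonglobal_minimizer f F y].
Proof.
move=> T1 [[[Fx xmin] xng] xns] fin; apply: xns; split=> //.
have xiso : nbhs x (~` ([set y | local_nonglobal_minimizer f F y] `\ x)).
  apply: open_nbhs_nbhs; split; last by move=> [_]; apply.
  apply: closed_openC; have [+ _] := @accessible_finite_set_closed T.
  by apply=> //; exact: finite_setD.
have xmin2 : \forall y \near x, \forall z \near y, F z -> f x <= f z.
  exact: nbhs_interior xmin.
apply: filterS2 xiso xmin2 => y yiso ymin Fy yx; rewrite ltNge; apply/negP => fyx.
apply: yiso; split=> //; split.
  by split=> //; apply: filterS ymin => z fxz Fz; apply: le_trans fyx (fxz Fz).
move=> [_ yglob]; apply: xng; split=> // z Fz.
exact: le_trans (nbhs_singleton ymin Fy) (yglob z Fz).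
Qed.

Section QuadraticForms.
Context {R : realType} {n : nat}.
Implicit Types (A B : 'M[R]_n) (x : 'cV[R]_n).

Lemma quadD A B x : quad (A + B) x = quad A x + quad B x.
Proof. by rewrite /quad mulmxDr mulmxDl mxE. Qed.

Lemma quadN A x : quad (- A) x = - quad A x.
Proof. by rewrite /quad mulmxN mulNmx mxE. Qed.

Lemma quad1 x : quad 1%:M x = \sum_i x i 0 ^+ 2.
Proof.
by rewrite /quad mulmx1 mxE; apply: eq_bigr => i _; rewrite mxE expr2.
Qed.

Lemma quad_delta i j x : quad (delta_mx i j) x = x i 0 * x j 0.
Proof.
rewrite /quad -(mul_delta_mx (0 : 'I_1)) mulmxA -colE -mulmxA -rowE.
by rewrite mxE big_ord1 !mxE.
Qed.

Definition sym_delta i j : 'M[R]_n := delta_mx i j + delta_mx j i.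

Lemma tr_sym_delta i j : (sym_delta i j)^T = sym_delta i j.
Proof. by rewrite /sym_delta raddfD /= !trmx_delta addrC. Qed.

Lemma quad_sym_delta i j x : quad (sym_delta i j) x = 2 * (x i 0 * x j 0).
Proof. by rewrite quadD !quad_delta; ring. Qed.

End QuadraticForms.

Section Witness.
Context {R : realType}.

Let A0 : 'M[R]_3 := sym_delta 0 2.
Let A1 : 'M[R]_3 := 1%:M.
Let A2 : 'M[R]_3 := 1%:M - sym_delta 0 1.

Lemma objectiveE (v : 'cV[R]_3) : quad A0 v = 2 * (v 0 0 * v 2 0).
Proof. exact: quad_sym_delta. Qed.

Lemma feasibleE (v : 'cV[R]_3) : feasible A1 A2 v <->
  v 0 0 ^+ 2 + v 1 0 ^+ 2 + v 2 0 ^+ 2 = 1 /\ 0 <= v 0 0 * v 1 0.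
Proof.
rewrite /feasible /= /A1 /A2 quadD quadN quad_sym_delta quad1.
rewrite !big_ord_recl big_ord0 addr0 addrA.
rewrite (_ : lift ord0 ord0 = 1); last exact/val_inj.
rewrite (_ : lift ord0 (lift ord0 ord0) = 2); last exact/val_inj.
by split=> -[-> ?]; split=> //; lra.
Qed.

Definition arc (t : R) : 'cV[R]_3 :=
  t *: delta_mx 1 0 + Num.sqrt (1 - t ^+ 2) *: delta_mx 2 0.

Lemma arcE (t : R) :
  (arc t 0 0 = 0) * (arc t 1 0 = t) * (arc t 2 0 = Num.sqrt (1 - t ^+ 2)).
Proof. by rewrite !mxE /= !mulr0 !mulr1 !addr0 add0r. Qed.

Lemma continuous_arc : continuous arc.
Proof.
move=> t; apply: cvgD; apply: cvgZr_tmp; first exact: cvg_id.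
apply: continuous_comp; last exact: sqrt_continuous.
by apply: cvgB; [exact: cvg_cst | exact: exprn_continuous].
Qed.

Lemma feasible_arc (t : R) : 0 < t < 1 -> feasible A1 A2 (arc t).
Proof.
move=> t01; apply/feasibleE; rewrite !arcE mul0r sqr_sqrtr; last by nra.
by split=> //; ring.
Qed.

Lemma objective_arc (t : R) : quad A0 (arc t) = 0.
Proof. by rewrite objectiveE !arcE mul0r mulr0. Qed.

Lemma arc_local_min (t : R) : 0 < t < 1 ->
  local_minimizer (quad A0) (feasible A1 A2) (arc t).
Proof.
move=> t01; split; first exact: feasible_arc.
have pos (i : 'I_3) : 0 < arc t i 0 -> \forall v \near arc t, 0 < (v : 'cV[R]_3)  i 0.
  move=> ti; apply: (@coord_continuous _ _ _ i 0 (arc t) (fun r => 0 < r)).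
  exact: lt_nbhsr.
have y_gt0 : \forall v \near arc t, 0 < (v : 'cV[R]_3)  1 0 by apply: pos; rewrite arcE; lra.
have z_gt0 : \forall v \near arc t, 0 < (v : 'cV[R]_3)  2 0.
  by apply: pos; rewrite arcE sqrtr_gt0; nra.
apply: filterS2 y_gt0 z_gt0 => v y0 z0 /feasibleE[_ xy].
by rewrite objective_arc objectiveE; rewrite pmulr_lge0 in xy; nra.
Qed.

(** The feasible point [(2/3, 1/3, -2/3)] has value [-8/9]. *)
Lemma arc_not_global (t : R) :
  ~ global_minimizer (quad A0) (feasible A1 A2) (arc t).
Proof.
pose v : 'cV[R]_3 := \col_i [:: 2 / 3; 1 / 3; - (2 / 3)]`_i.
move=> [_ /(_ v)]; rewrite objective_arc objectiveE feasibleE !mxE /=.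
by move=> H; suff : 0 <= 2 * (2 / 3 * - (2 / 3)) :> R by [lra]; apply: H; lra.
Qed.

Lemma arc_nonstrict (t : R) : 0 < t < 1 ->
  nonstrict_local_nonglobal_minimizer (quad A0) (feasible A1 A2) (arc t).
Proof.
move=> t01; split.
  by split; [exact: arc_local_min | exact: arc_not_global].
move=> [_ strict].
have near_strict : \forall s \near t^', feasible A1 A2 (arc s) ->
    arc s <> arc t -> quad A0 (arc t) < quad A0 (arc s).
  by apply: nbhs_dnbhs; exact: (continuous_arc t _ strict).
have near01 : \forall s \near t^', 0 < s < 1.
  apply: nbhs_dnbhs.
  have := @near_in_itvoo R 0 1 t; rewrite in_itv /= => /(_ t01).
  by apply: filterS => s; rewrite in_itv.
have near_neq : \forall s \near t^', s != t by exact: nbhs_dnbhs_neq.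
have [s [s01 [st]]] := filter_ex (filterI near01 (filterI near_neq near_strict)).
rewrite !objective_arc ltxx => /(_ (feasible_arc _ s01)) lt_st.
suff : false by []; apply: lt_st => st_arc.
by move/eqP: st; apply; rewrite -(arcE s).1.2 st_arc arcE.
Qed.

Lemma witness_minimizers :
  [/\ [/\ A0^T = A0, A1^T = A1 & A2^T = A2],
      exists x : 'cV[R]_3,
        nonstrict_local_nonglobal_minimizer (quad A0) (feasible A1 A2) x
    & infinite_set [set x : 'cV[R]_3 |
        local_nonglobal_minimizer (quad A0) (feasible A1 A2) x]].
Proof.
have arc_half := arc_nonstrict (1 / 2) ltac:(lra).
split; last 1 first.
- apply: infinite_nonstrict_minimizers arc_half.
  by apply: hausdorff_accessible; exact: norm_hausdorff.
- split; first exact: tr_sym_delta.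
    exact: trmx1.
  by rewrite /A2 raddfB /= trmx1 tr_sym_delta.
- by exists (arc (1 / 2)).
Qed.

End Witness.

Theorem mainTheorem12 (R : realType) :
  exists (n : nat) (A0 A1 A2 : 'M[R]_n),
    [/\ (3 <= n)%N,
        [/\ A0^T = A0, A1^T = A1 & A2^T = A2],
        exists x : 'cV[R]_n,
          nonstrict_local_nonglobal_minimizer (quad A0) (feasible A1 A2) x
      & infinite_set [set x : 'cV[R]_n |
          local_nonglobal_minimizer (quad A0) (feasible A1 A2) x]].
Proof.
have [sym nonstrict infinite] := @witness_minimizers R.
by exists 3, (sym_delta 0 2), 1%:M, (1%:M - sym_delta 0 1); split.
Qed.
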